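(* Let $B$ be an ungraded Hopf algebra. If $B$ is commutative and $t\in B$ is trace-like, then the bilinear form $\bullet_t:B\times B\to\mathbb{K}$ defined by $b\bullet_tc=\overline b(c)$ is a balanced biderivation in $B$, where $\overline b=\overline b_t$ is the derivation $B\to\mathbb K$ associated to $b$ via $t$. Moreover, for any $b,c\in B$, $$b\bullet_tc=(b\bullet_tt')\,(c\bullet_tt'').$$
   Context: $\mathbb{K}$ is a fixed commutative ring; $B$ is an (ungraded) Hopf algebra over $\mathbb{K}$ with comultiplication $\Delta$, counit $\varepsilon$, antipode $s$. Sweedler notation: $\Delta(b)=b'\otimes b''$, $(\Delta\otimes\mathrm{id})\Delta(b)=b'\otimes b''\otimes b'''$. Let $I=\mathrm{Ker}\,\varepsilon$ and let $p:B\to I/I^2$ be $p(b)=b-\varepsilon(b)1_B\bmod I^2$. A derivation $B\to\mathbb{K}$ is a linear map $\mu$ with $\mu(bc)=\varepsilon(b)\mu(c)+\varepsilon(c)\mu(b)$; let $\mathfrak g$ be the module of all such derivations. An element $t\in B$ is cosymmetric if $t'\otimes t''=t''\otimes t'$; it is infinitesimally-nonsingular if the linear map $\mathfrak g\to I/I^2$, $\mu\mapsto\mu(t')\,p(t'')$ is an isomorphism; it is trace-like if it is both. For an infinitesimally-nonsingular $t$ and $b\in B$, $\overline b=\overline b_t\in\mathfrak g$ denotes the preimage of $p(b)$ under this isomorphism. A bilinear form $\bullet:B\times B\to\mathbb{K}$ is a biderivation if $(bc)\bullet d=\varepsilon(b)\,c\bullet d+\varepsilon(c)\,b\bullet d$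 and $b\bullet(cd)=\varepsilon(c)\,b\bullet d+\varepsilon(d)\,b\bullet c$ for all $b,c,d$. It is balanced if $(b\bullet c'')\,s(c')c'''=(c\bullet b'')\,s(b''')b'$ for all $b,c\in B$. *)

(* Defs.v *)
From HB Require Import structures.
From mathcomp Require Import all_boot all_order all_algebra generic_quotient.
From mathcomp Require Import boolp classical_sets functions.
From mathcomp Require Import freeg.

Set Implicit Arguments.
Unset Strict Implicit.
Unset Printing Implicit Defensive.

Import GRing.Theory.
Local Open Scope ring_scope.
Local Open Scope quotient_scope.

Reserved Notation "x *t y" (at level 40, left associativity).

Section ModuleQuotient.
Variables (K : nzRingType) (M : lmodType K) (S : M -> Prop).

Definition is_submodule (P : M -> Prop) : Prop :=
  [/\ P 0, forall x y, P x -> P y -> P (x + y)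
    & forall a x, P x -> P (a *: x)].

Definition spanned (x : M) : Prop :=
  forall P : M -> Prop, is_submodule P -> (forall s, S s -> P s) -> P x.

Lemma spanned_sub s : S s -> spanned s.
Proof. by move=> Ss P _; apply. Qed.

Lemma spanned_submodule : is_submodule spanned.
Proof.
split=> [P [P0 _ _] //|x y Sx Sy P subP SP|a x Sx P subP SP].
  by case: (subP) => _ PD _; apply: PD; [apply: Sx|apply: Sy].
by case: (subP) => _ _ PZ; apply: PZ; apply: Sx.
Qed.

Let spanned0 : spanned 0. Proof. by have [] := spanned_submodule. Qed.
Let spannedD x y : spanned x -> spanned y -> spanned (x + y).
Proof. by have [_ + _] := spanned_submodule; apply. Qed.
Let spannedZ a x : spanned x -> spanned (a *: x).
Proof. by have [_ _] := spanned_submodule; apply. Qed.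
Let spannedN x : spanned x -> spanned (- x).
Proof. by rewrite -scaleN1r; apply: spannedZ. Qed.

Definition eqmod_span : rel M := fun x y => `[< spanned (x - y) >].

Lemma eqmod_span_equiv : equiv_class_of eqmod_span.
Proof.
split=> [x|x y|y x z].
- by apply/asboolP; rewrite subrr.
- by apply/asboolP/asboolP => /spannedN; rewrite opprB.
- move=> /asboolP xy /asboolP yz; apply/asboolP.
  by rewrite -(subrKA y); apply: spannedD.
Qed.

Canonical eqmod_span_rel := EquivRelPack eqmod_span_equiv.
Canonical eqmod_span_enc := defaultEncModRel eqmod_span.

Definition modquot := {eq_quot eqmod_span}.
HB.instance Definition _ : EqQuotient M eqmod_span modquot := EqQuotient.on modquot.
HB.instance Definition _ := Choice.on modquot.

Definition mproj (x : M) : modquot := \pi_modquot x.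

Lemma mprojP x y : mproj x = mproj y <-> spanned (x - y).
Proof. by split => [/eqmodP/asboolP|h]; [|apply/eqmodP/asboolP]. Qed.

Lemma mproj_repr z : mproj (repr z) = z.
Proof. exact: reprK. Qed.

Let qzero : modquot := mproj 0.
Let qadd (x y : modquot) : modquot := mproj (repr x + repr y).
Let qopp (x : modquot) : modquot := mproj (- repr x).
Let qscale (a : K) (x : modquot) : modquot := mproj (a *: repr x).

Let sp x : spanned (repr (mproj x) - x).
Proof. by apply/mprojP; rewrite mproj_repr. Qed.

Let qaddE x y : qadd (mproj x) (mproj y) = mproj (x + y).
Proof. by apply/mprojP; rewrite opprD addrACA; apply: spannedD; apply: sp. Qed.
Let qoppE x : qopp (mproj x) = mproj (- x).
Proof. by apply/mprojP; rewrite -opprD; apply: spannedN; apply: sp. Qed.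
Let qscaleE a x : qscale a (mproj x) = mproj (a *: x).
Proof. by apply/mprojP; rewrite -scalerBr; apply: spannedZ; apply: sp. Qed.

Let ind (P : modquot -> Prop) : (forall x, P (mproj x)) -> forall z, P z.
Proof. by move=> h z; rewrite -[z]mproj_repr. Qed.

Let qaddA : associative qadd.
Proof. by elim/ind=> x; elim/ind=> y; elim/ind=> z; rewrite !qaddE addrA. Qed.
Let qaddC : commutative qadd.
Proof. by elim/ind=> x; elim/ind=> y; rewrite !qaddE addrC. Qed.
Let qadd0 : left_id qzero qadd.
Proof. by elim/ind=> x; rewrite qaddE add0r. Qed.
Let qaddN : left_inverse qzero qopp qadd.
Proof. by elim/ind=> x; rewrite qoppE qaddE addNr. Qed.

HB.instance Definition _ :=
  GRing.isZmodule.Build modquot qaddA qaddC qadd0 qaddN.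

Let qscaleA a b x : qscale a (qscale b x) = qscale (a * b) x.
Proof. by elim/ind: x => x; rewrite !qscaleE scalerA. Qed.
Let qscale1 : left_id 1 qscale.
Proof. by elim/ind=> x; rewrite qscaleE scale1r. Qed.
Let qscaleDr : right_distributive qscale +%R.
Proof.
move=> a; elim/ind=> x; elim/ind=> y; rewrite -[_ + _]/(qadd _ _).
by rewrite -[RHS]/(qadd _ _) qaddE !qscaleE qaddE scalerDr.
Qed.
Let qscaleDl v : {morph qscale^~ v : a b / a + b}.
Proof.
elim/ind: v => x a b; rewrite -[RHS]/(qadd _ _).
by rewrite !qscaleE qaddE scalerDl.
Qed.

HB.instance Definition _ := GRing.Zmodule_isLmodule.Build K modquot
  qscaleA qscale1 qscaleDr qscaleDl.

Lemma mproj_is_linear : linear mproj.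
Proof.
move=> a x y.
have -> : a *: mproj x + mproj y = qadd (qscale a (mproj x)) (mproj y) by [].
by rewrite qscaleE qaddE.
Qed.

HB.instance Definition _ := GRing.isLinear.Build K M modquot *:%R mproj
  mproj_is_linear.

End ModuleQuotient.

Section Tensor.
Variable K : comNzRingType.

Section Construction.
Variables M N : lmodType K.

Inductive tens_rel : {freeg (M * N) / K} -> Prop :=
| TensDl x x' y : tens_rel (<< (x + x', y) >> - (<< (x, y) >> + << (x', y) >>))
| TensDr x y y' : tens_rel (<< (x, y + y') >> - (<< (x, y) >> + << (x, y') >>))
| TensZl a x y : tens_rel (<< (a *: x, y) >> - a *: << (x, y) >>)
| TensZr a x y : tens_rel (<< (x, a *: y) >> - a *: << (x, y) >>).

Definition tens := modquot tens_rel.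
HB.instance Definition _ := GRing.Lmodule.on tens.

Definition pure_tens (x : M) (y : N) : tens := mproj tens_rel << (x, y) >>.

End Construction.

Local Notation "x *t y" := (pure_tens x y).

(* The map on the tensor product induced by f : for f bilinear, the unique
   linear map sending x *t y to f x y (see tlift_linear, tliftE, tlift_uniq);
   of no significance if f is not bilinear. *)
Definition tlift (M N V : lmodType K) (f : M -> N -> V) (z : tens M N) : V :=
  fglift (fun p => f p.1 p.2) (repr z).

Section Theory.
Variables M N V : lmodType K.
Implicit Types f : M -> N -> V.

Lemma pure_tens_bilinear :
  bilinear_for *:%R *:%R (@pure_tens M N).
Proof.
have E u v : tens_rel (u - v) -> mproj (@tens_rel M N) u = mproj (@tens_rel M N) v.
  by move=> h; apply/mprojP; apply: spanned_sub.
split=> [y a x x'|x a y y'] /=.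
  have -> : a *: (x *t y) + x' *t y
      = mproj (@tens_rel M N) (a *: << (x, y) >> + << (x', y) >>).
    by rewrite linearP.
  rewrite /pure_tens (E _ _ (TensDl _ _ _)) !linearD /=.
  by rewrite (E _ _ (TensZl _ _ _)).
have -> : a *: (x *t y) + x *t y'
    = mproj (@tens_rel M N) (a *: << (x, y) >> + << (x, y') >>).
  by rewrite linearP.
rewrite /pure_tens (E _ _ (TensDr _ _ _)) !linearD /=.
by rewrite (E _ _ (TensZr _ _ _)).
Qed.

Lemma fgliftE (T : choiceType) (f : T -> V) (D : {freeg T / K}) :
  fglift f D = \sum_(p <- dom D) coeff p D *: f p.
Proof.
pose L : {additive {freeg T / K} -> V} := HB.pack (fglift f)
  (GRing.isZmodMorphism.Build {freeg T / K} V (fglift f) (lift_is_additive f)).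
rewrite -[in LHS](freeg_sumE D) -[fglift f]/(L : _ -> _) raddf_sum.
by apply: eq_bigr => p _ /=; rewrite liftU.
Qed.

Lemma fglift_linear (T : choiceType) (f : T -> V) :
  linear (fglift f : {freeg T / K} -> V).
Proof.
pose L : {additive {freeg T / K} -> V} := HB.pack (fglift f)
  (GRing.isZmodMorphism.Build {freeg T / K} V (fglift f) (lift_is_additive f)).
move=> a x y; rewrite -[fglift f]/(L : _ -> _) raddfD /=; congr (_ + _).
rewrite [in RHS]fgliftE scaler_sumr -[in LHS](freeg_sumE x) scaler_sumr.
rewrite -[fglift f]/(L : _ -> _) raddf_sum; apply: eq_bigr => i _ /=.
have -> : a *: (<< coeff i x *g i >> : {freeg T / K}) = << a * coeff i x *g i >>.
  by apply/eqP/freeg_eqP => j; rewrite coeffZ !coeffU mulrA.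
by rewrite liftU scalerA.
Qed.

Lemma tlift_mproj f u : bilinear_for *:%R *:%R f ->
  tlift f (mproj (@tens_rel M N) u) = fglift (fun p => f p.1 p.2) u.
Proof.
case=> fl fr; set g := fun p : M * N => f p.1 p.2.
have gl := fglift_linear g.
pose G := GRing.isLinear.Build K {freeg (M * N) / K} V *:%R (fglift g) gl.
pose F : {linear {freeg (M * N) / K} -> V} := HB.pack (fglift g) G.
have FE p : F << p >> = g p by rewrite /= liftU scale1r.
have [fD1 fZ1] : (forall x x' y, f (x + x') y = f x y + f x' y)
     /\ (forall a x y, f (a *: x) y = a *: f x y).
  have D x x' y : f (x + x') y = f x y + f x' y.
    by have := fl y 1 x x'; rewrite /= !scale1r.
  split=> // a x y; have f0 : f 0 y = 0.
    by apply: (addrI (f 0 y)); rewrite -D !addr0.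
  by have := fl y a x 0; rewrite /= addr0 f0 addr0.
have [fD2 fZ2] : (forall x y y', f x (y + y') = f x y + f x y')
     /\ (forall a x y, f x (a *: y) = a *: f x y).
  have D x y y' : f x (y + y') = f x y + f x y'.
    by have := fr x 1 y y'; rewrite /= !scale1r.
  split=> // a x y; have f0 : f x 0 = 0.
    by apply: (addrI (f x 0)); rewrite -D !addr0.
  by have := fr x a y 0; rewrite /= addr0 f0 addr0.
have FD u' v' : F (u' + v') = F u' + F v' by exact: linearD.
have FZ a u' : F (a *: u') = a *: F u' by exact: linearZ.
have FB u' v' : F (u' - v') = F u' - F v' by exact: linearB.
have F0 w : spanned (@tens_rel M N) w -> F w = 0.
  move=> /(_ (fun v => F v = 0)) h; apply: h.
    split; first exact: linear0.
    - by move=> x y Fx Fy; rewrite FD Fx Fy addr0.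
    - by move=> a x Fx; rewrite FZ Fx scaler0.
  move=> s [x x' y|x y y'|a x y|a x y]; rewrite FB ?FD ?FZ !FE /g /=.
  - by rewrite fD1 subrr.
  - by rewrite fD2 subrr.
  - by rewrite fZ1 subrr.
  - by rewrite fZ2 subrr.
have /F0 : spanned (@tens_rel M N) (repr (mproj (@tens_rel M N) u) - u).
  by apply/mprojP; rewrite mproj_repr.
by rewrite FB => /eqP; rewrite subr_eq0 => /eqP.
Qed.

Lemma tlift_linear f : bilinear_for *:%R *:%R f -> linear (tlift f).
Proof.
move=> fb a x y; rewrite -[x]mproj_repr -[y]mproj_repr -linearP.
by rewrite !tlift_mproj //; apply: fglift_linear.
Qed.

Lemma tliftE f x y : bilinear_for *:%R *:%R f -> tlift f (x *t y) = f x y.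
Proof. by move=> fb; rewrite tlift_mproj // liftU scale1r. Qed.

Lemma tlift_uniq (g h : tens M N -> V) : linear g -> linear h ->
  (forall x y, g (x *t y) = h (x *t y)) -> forall z, g z = h z.
Proof.
move=> gl hl gh z.
pose G : {linear tens M N -> V} :=
  HB.pack g (GRing.isLinear.Build K (tens M N) V *:%R g gl).
pose H : {linear tens M N -> V} :=
  HB.pack h (GRing.isLinear.Build K (tens M N) V *:%R h hl).
change (G z = H z); rewrite -[z]mproj_repr -[repr z]freeg_sumE !linear_sum /=.
apply: eq_bigr => -[x y] _; set a := coeff _ _.
have -> : << a *g (x, y) >> = a *: (<< (x, y) >> : {freeg (M * N) / K}).
  by apply/eqP/freeg_eqP => j; rewrite coeffZ !coeffU mul1r.
rewrite linearZ; change (G (a *: (x *t y)) = H (a *: (x *t y))).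
by rewrite !linearZ; congr (_ *: _); apply: gh.
Qed.

Lemma tliftP f g a z :
  tlift (fun x y => a *: f x y + g x y) z = a *: tlift f z + tlift g z.
Proof.
rewrite /tlift !fgliftE scaler_sumr -big_split; apply: eq_bigr => p _ /=.
by rewrite scalerDr !scalerA mulrC.
Qed.

End Theory.

Definition tmap (M N M' N' : lmodType K) (f : M -> M') (g : N -> N') :
    tens M N -> tens M' N' :=
  tlift (fun x y => f x *t g y).

Definition tswap (M N : lmodType K) : tens M N -> tens N M :=
  tlift (fun x y => y *t x).

Definition tassoc (M N P : lmodType K) :
    tens M (tens N P) -> tens (tens M N) P :=
  tlift (fun x => tlift (fun y z => (x *t y) *t z)).

Definition tmul (A B : algType K) (u v : tens A B) : tens A B :=
  tlift (fun a b => tlift (fun a' b' => (a * a') *t (b * b')) v) u.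

End Tensor.

Notation "x *t y" := (pure_tens x y) : ring_scope.

HB.mixin Record Algebra_isHopf (K : comNzRingType) B of GRing.Algebra K B := {
  comul : {linear B -> tens B B};
  counit : {scalar B};
  antipode : {linear B -> B};
  comulA : forall b,
    tmap comul idfun (comul b) = tassoc (tmap idfun comul (comul b));
  counit_comull : forall b, tlift (fun x y => counit x *: y) (comul b) = b;
  counit_comulr : forall b, tlift (fun x y => counit y *: x) (comul b) = b;
  comul1 : comul 1 = 1 *t 1;
  comulM : forall b c, comul (b * c) = tmul (comul b) (comul c);
  counit1 : counit 1 = 1;
  counitM : forall b c, counit (b * c) = counit b * counit c;
  antipodel : forall b,
    tlift (fun x y => antipode x * y) (comul b) = (counit b)%:A;
  antipoder : forall b,
    tlift (fun x y => x * antipode y) (comul b) = (counit b)%:A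
}.

#[short(type="hopfAlgType")]
HB.structure Definition HopfAlgebra (K : comNzRingType) :=
  {B of GRing.Algebra K B & Algebra_isHopf K B}.

Section HopfAlgebra.
Variables (K : comNzRingType) (B : hopfAlgType K).
Implicit Types (b c t : B).

Local Notation eps := (@counit K B).
Local Notation antip := (@antipode K B).

(* Sweedler notation: for multilinear f, sweedler2 f b is f(b',b'') and
   sweedler3 f b is f(b',b'',b'''), summation being understood. *)
Definition sweedler2 (V : lmodType K) (f : B -> B -> V) b : V :=
  tlift f (comul b).

Definition sweedler3 (V : lmodType K) (f : B -> B -> B -> V) b : V :=
  tlift (fun u z => tlift (fun x y => f x y z) u) (tmap comul idfun (comul b)).

Definition in_aug_ideal : pred B := fun b => eps b == 0.

Definition aug_ideal := {b : B | in_aug_ideal b}.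
HB.instance Definition _ := SubType.on aug_ideal.
HB.instance Definition _ := Choice.on aug_ideal.

Lemma in_aug_idealE b : (b \in in_aug_ideal) = (eps b == 0).
Proof. by []. Qed.

Lemma in_aug_ideal_submod : subsemimod_closed in_aug_ideal.
Proof.
split; first split; rewrite ?in_aug_idealE ?linear0 //.
  move=> b c; rewrite !in_aug_idealE linearD => /eqP -> /eqP ->.
  by rewrite addr0.
by move=> a b; rewrite !in_aug_idealE linearZ => /eqP /= ->; rewrite mulr0.
Qed.
HB.instance Definition _ :=
  GRing.SubChoice_isSubLmodule.Build K B in_aug_ideal aug_ideal
    in_aug_ideal_submod.

(* With I = aug_ideal, cotangent is I / I^2: the square of an ideal is the
   K-span of the products of two of its elements. *)
Definition aug_prod (z : aug_ideal) : Prop :=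
  exists x y : aug_ideal, \val z = \val x * \val y.

Definition cotangent := modquot aug_prod.
HB.instance Definition _ := GRing.Lmodule.on cotangent.

Lemma sub_counit_in_aug_ideal b : in_aug_ideal (b - (eps b)%:A).
Proof.
by rewrite /in_aug_ideal linearB linearZ /= counit1 mulr1 subrr.
Qed.

Definition aug_part b : aug_ideal :=
  exist _ (b - (eps b)%:A) (sub_counit_in_aug_ideal b).

Definition cotangent_proj b : cotangent := mproj aug_prod (aug_part b).

Lemma cotangent_proj_is_linear : linear cotangent_proj.
Proof.
move=> a b c; rewrite /cotangent_proj -linearP; congr (mproj _ _).
apply: (@val_inj _ _ aug_ideal).
rewrite (linearP (\val : aug_ideal -> B)) /= linearP.
by rewrite scalerDl opprD addrACA scalerBr scalerA.
Qed.
HB.instance Definition _ := GRing.isLinear.Build K B cotangent *:%R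
  cotangent_proj cotangent_proj_is_linear.

Definition is_derivation (mu : B -> K^o) : Prop :=
  linear mu /\ forall b c, mu (b * c) = eps b * mu c + eps c * mu b.

Definition is_derivationb : pred (B -> K^o) := fun mu => `[< is_derivation mu >].

Definition derivation := {mu : B -> K^o | is_derivationb mu}.
HB.instance Definition _ := SubType.on derivation.
HB.instance Definition _ := Choice.on derivation.

Definition derivation_fun (mu : derivation) : B -> K := \val mu.
Coercion derivation_fun : derivation >-> Funclass.

Lemma in_derivationP mu :
  reflect (is_derivation mu) (mu \in is_derivationb).
Proof. exact: asboolP. Qed.

Lemma is_derivationb_submod : subsemimod_closed is_derivationb.
Proof.
split; first split.
- apply/in_derivationP; split=> [a b c|b c].
    by rewrite -[LHS]/0 -[RHS]/(a *: 0 + 0) scaler0 addr0.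
  by rewrite -[LHS]/0 -[RHS]/(eps b * 0 + eps c * 0) !mulr0 addr0.
- move=> f g /in_derivationP [fl fM] /in_derivationP [gl gM].
  apply/in_derivationP; split=> [a b c|b c] /=; rewrite !fctE.
    by rewrite fl gl scalerDr addrACA.
  by rewrite fM gM !mulrDr addrACA.
- move=> a f /in_derivationP [fl fM].
  apply/in_derivationP; split=> [k b c|b c] /=; rewrite !fctE.
    by rewrite fl scalerDr !scalerA mulrC.
  rewrite fM scalerDr /=; congr (_ + _); exact: mulrCA.
Qed.
HB.instance Definition _ :=
  GRing.SubChoice_isSubLmodule.Build K (B -> K^o) is_derivationb derivation
    is_derivationb_submod.

Definition contraction t (mu : derivation) : cotangent :=
  sweedler2 (fun x y => mu x *: cotangent_proj y) t.

Lemma contraction_is_linear t : linear (contraction t).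
Proof.
move=> a mu nu; rewrite /contraction /sweedler2 -tliftP; congr tlift.
by apply/funext => x; apply/funext => y; rewrite scalerA -scalerDl.
Qed.
HB.instance Definition _ t := GRing.isLinear.Build K derivation cotangent *:%R
  (contraction t) (contraction_is_linear t).

Definition cosymmetric t : Prop := tswap (comul t) = comul t.

(* contraction t is K-linear, so bijective means isomorphism of modules. *)
Definition infinitesimally_nonsingular t : Prop := bijective (contraction t).

Definition trace_like t : Prop :=
  cosymmetric t /\ infinitesimally_nonsingular t.

(* The preimage of cotangent_proj b under contraction t; the default value 0
   is taken only if there is no preimage. *)
Definition assoc_derivation t b : derivation :=
  xget 0 [set mu | contraction t mu = cotangent_proj b].

Definition trace_form t : B -> B -> K := fun b c => assoc_derivation t b c.

Definition biderivation (f : B -> B -> K) : Prop :=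
  [/\ bilinear_for *%R *%R f,
      forall b c d, f (b * c) d = eps b * f c d + eps c * f b d
    & forall b c d, f b (c * d) = eps c * f b d + eps d * f b c].

Definition balanced (f : B -> B -> K) : Prop :=
  forall b c,
    sweedler3 (fun c1 c2 c3 => f b c2 *: (antip c1 * c3)) c =
    sweedler3 (fun b1 b2 b3 => f c b2 *: (antip b3 * b1)) b.

End HopfAlgebra.

(* Main.v *)
Require Import Defs.
From HB Require Import structures.
From mathcomp Require Import all_boot all_order all_algebra.
From mathcomp Require Import classical_sets.

Set Implicit Arguments.
Unset Strict Implicit.
Unset Printing Implicit Defensive.

Import GRing.Theory.
Local Open Scope ring_scope.

(** Read B as the algebra of functions on a group G = Spec B: the elements of
    the module g of derivations are tangent vectors at the unit, I / I^2 is
    the cotangent space, and a cosymmetric t is a class function on G.  The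
    contraction g -> I / I^2 is given by the second-order part of t at the
    unit, which defines a bilinear form on g; as t is a class function, this
    form is invariant under conjugation, and [trace_form t] is the inverse
    form, on I / I^2.  Being balanced is the invariance of the inverse form
    under the universal conjugation.

    Algebraically, everything rests on one reproducing formula
    ([trace_form_expand]).  Write m_b for the derivation associated with b.
    A linear map nu from B to any module with
    nu (b c) = eps b nu c + eps c nu b factors through I / I^2, and applying
    it to m_b(t') p(t'') = p(b) gives nu b = m_b(t') nu(t'').

    - With nu = m_c the formula reads m_c b = m_b(t') m_c(t''), which
      together with cosymmetry is the contraction formula
      ([trace_form_contract]).
    - The form is a derivation in its second argument by construction.  In
      its first one it inherits the Leibniz rule of p, because the
      contraction is injective ([trace_form_biderivation]).
    - For the balance condition ([trace_form_balanced]), denote by * the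
      convolution of linear maps B -> B, in which the antipode s is inverse
      to the identity, and see m_b, m_c as maps into B.  The two sides of the
      condition are the values F_b(c) and G_c(b) of the conjugates
      F_b = s * m_b * id and G_c = id * m_c * s.  Since B is commutative, s
      is multiplicative ([antipodeM]), hence F_b and G_c satisfy the Leibniz
      rule above, and the reproducing formula gives
      F_b(c) = (m_c * s * m_b * id)(t) and G_c(b) = (m_b * id * m_c * s)(t).
      These agree because f * h and h * f take the same value at a
      cosymmetric t ([conv_cosymmetric]). *)

(** * Sums over tensors and Sweedler calculus *)

Section TensorSums.
Variable K : comNzRingType.

Lemma eq_tlift (M N V : lmodType K) (f g : M -> N -> V) :
  f =2 g -> tlift f =1 tlift g.
Proof.
by move=> fg z; rewrite /tlift !fgliftE; apply: eq_bigr => p _; rewrite fg.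
Qed.

(** [tlift f] is a finite linear combination of values of f, even when f is
    not bilinear; linear maps therefore always commute with it. *)
Lemma linear_tlift (M N V W : lmodType K) (L : {linear V -> W})
    (f : M -> N -> V) z :
  L (tlift f z) = tlift (fun x y => L (f x y)) z.
Proof.
rewrite /tlift !fgliftE linear_sum; apply: eq_bigr => p _.
by rewrite linearZ.
Qed.

(** The variant for maps that carry no canonical linear structure, such as the
    partial applications of a bilinear map. *)
Lemma linear_fun_tlift (M N V W : lmodType K) (L : V -> W)
    (f : M -> N -> V) z : linear L ->
  L (tlift f z) = tlift (fun x y => L (f x y)) z.
Proof.
move=> linL; pose L' : {linear V -> W} :=
  HB.pack L (GRing.isLinear.Build K V W *:%R L linL).
exact: (linear_tlift L').
Qed.

Lemma tlift_tmap (M N M' N' V : lmodType K) (f : M -> M') (g : N -> N')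
    (h : M' -> N' -> V) z : bilinear_for *:%R *:%R h ->
  tlift h (tmap f g z) = tlift (fun x y => h (f x) (g y)) z.
Proof.
move=> hh; rewrite linear_fun_tlift; last exact: tlift_linear.
by apply: eq_tlift => x y; rewrite tliftE.
Qed.

Lemma tlift_family_linear (L M N V : lmodType K) (F : L -> M -> N -> V) z :
    (forall x y, linear (fun w => F w x y)) ->
  linear (fun w => tlift (F w) z).
Proof.
move=> linF a w w'; rewrite -tliftP; apply: eq_tlift => x y.
exact: (linF x y).
Qed.

Lemma pure_tens_linearl (M N : lmodType K) (y : N) :
  linear (fun x : M => x *t y).
Proof. by case: (pure_tens_bilinear M N). Qed.

Lemma pure_tens_linearr (M N : lmodType K) (x : M) :
  linear (fun y : N => x *t y).
Proof. by case: (pure_tens_bilinear M N). Qed.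

End TensorSums.

Section Sweedler.
Variables (K : comNzRingType) (B : hopfAlgType K).

Local Notation eps := (@counit K B).

Lemma eq_sweedler2 (V : lmodType K) (f g : B -> B -> V) b :
  f =2 g -> sweedler2 f b = sweedler2 g b.
Proof. by move=> fg; apply: eq_tlift. Qed.

Lemma sweedler2D (V : lmodType K) (f g : B -> B -> V) b :
  sweedler2 (fun x y => f x y + g x y) b = sweedler2 f b + sweedler2 g b.
Proof.
rewrite -[sweedler2 f b]scale1r /sweedler2 -tliftP.
by apply: eq_tlift => x y; rewrite scale1r.
Qed.

Lemma sweedler2_linear (V : lmodType K) (f : B -> B -> V) :
  bilinear_for *:%R *:%R f -> linear (sweedler2 f).
Proof.
by move=> ff a b c; rewrite /sweedler2 linearP tlift_linear.
Qed.

Lemma sweedler2M (V : lmodType K) (f : B -> B -> V) b c :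
    bilinear_for *:%R *:%R f ->
  sweedler2 f (b * c) =
  sweedler2 (fun x y => sweedler2 (fun z w => f (x * z) (y * w)) c) b.
Proof.
move=> ff; rewrite /sweedler2 comulM /tmul.
rewrite linear_fun_tlift; last exact: tlift_linear.
apply: eq_tlift => x y.
rewrite linear_fun_tlift; last exact: tlift_linear.
by apply: eq_tlift => z w; rewrite tliftE.
Qed.

Lemma sweedler2_cosymmetric (V : lmodType K) (f : B -> B -> V) t :
    cosymmetric t -> bilinear_for *:%R *:%R f ->
  sweedler2 f t = sweedler2 (fun x y => f y x) t.
Proof.
move=> cos_t ff; rewrite {1}/sweedler2 -cos_t /tswap.
rewrite linear_fun_tlift; last exact: tlift_linear.
by apply: eq_tlift => x y; rewrite tliftE.
Qed.

Lemma sweedler2_counitr (V : lmodType K) (f : {linear B -> V}) b :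
  sweedler2 (fun x y => eps y *: f x) b = f b.
Proof.
rewrite -[in RHS](counit_comulr b) linear_tlift.
by apply: eq_tlift => x y; rewrite linearZ.
Qed.

Definition trilinear (V : lmodType K) (F : B -> B -> B -> V) : Prop :=
  [/\ forall y z, linear (fun x => F x y z),
      forall x z, linear (fun y => F x y z)
    & forall x y, linear (fun z => F x y z)].

Lemma trilinear_tlift (V : lmodType K) (F : B -> B -> B -> V) : trilinear F ->
  bilinear_for *:%R *:%R
    (fun (u : tens B B) z => tlift (fun x y => F x y z) u).
Proof.
case=> F1 F2 F3; split=> [z|u] /=.
  by apply: tlift_linear; split=> [y|x] /=.
by apply: tlift_family_linear => x y; apply: F3.
Qed.

Lemma sweedler3_left (V : lmodType K) (F : B -> B -> B -> V) b : trilinear F ->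
  sweedler3 F b = sweedler2 (fun u z => sweedler2 (fun x y => F x y z) u) b.
Proof. by move=> /trilinear_tlift FF; rewrite /sweedler3 tlift_tmap. Qed.

(** Coassociativity, in the form of a rule for iterated Sweedler sums: with
    [sweedler3_left], a triple sum may be split at either end. *)
Lemma sweedler3_right (V : lmodType K) (F : B -> B -> B -> V) b : trilinear F ->
  sweedler3 F b = sweedler2 (fun x u => sweedler2 (fun y z => F x y z) u) b.
Proof.
move=> triF; have [F1 F2 F3] := triF.
have triP : trilinear (fun x y z : B => (x *t y) *t z).
  split=> [y z|x z|x y] a u v /=; last exact: pure_tens_linearr.
    by rewrite pure_tens_linearl pure_tens_linearl.
  by rewrite pure_tens_linearr pure_tens_linearl.
have bilR (W : lmodType K) (G : B -> B -> B -> W) : trilinear G ->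
  bilinear_for *:%R *:%R (fun x (u : tens B B) => tlift (G x) u).
  case=> G1 G2 G3; split=> [u|x] /=.
    by apply: tlift_family_linear => y z; apply: G1.
  by apply: tlift_linear; split.
rewrite /sweedler3 comulA /tassoc tlift_tmap; last exact: bilR triP.
rewrite linear_fun_tlift; last exact/tlift_linear/trilinear_tlift.
apply: eq_tlift => x u.
rewrite linear_fun_tlift; last exact/tlift_linear/trilinear_tlift.
apply: eq_tlift => y z.
rewrite tliftE; last exact: trilinear_tlift.
by rewrite tliftE; split.
Qed.

End Sweedler.

(** * Convolution *)

Section Convolution.
Variables (K : comNzRingType) (B : hopfAlgType K) (A : algType K).
Implicit Types f g h : {linear B -> A}.

Local Notation eps := (@counit K B).

Lemma sweedler2_mull (F : B -> B -> A) (a : A) b :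
  a * sweedler2 F b = sweedler2 (fun x y => a * F x y) b.
Proof.
by apply: (linear_fun_tlift (L := *%R a)) => k u v; rewrite mulrDr scalerAr.
Qed.

Lemma sweedler2_mulr (F : B -> B -> A) (a : A) b :
  sweedler2 F b * a = sweedler2 (fun x y => F x y * a) b.
Proof.
apply: (linear_fun_tlift (L := fun u => u * a)) => k u v.
by rewrite mulrDl scalerAl.
Qed.

Definition conv f g (b : B) : A := sweedler2 (fun x y => f x * g y) b.

Lemma mul_bilinear f g :
  bilinear_for *:%R *:%R (fun x y => f x * g y).
Proof.
split=> [y a x x'|x a y y'] /=; rewrite linearP.
  by rewrite mulrDl scalerAl.
by rewrite mulrDr scalerAr.
Qed.

Lemma conv_linear f g : linear (conv f g).
Proof. exact/sweedler2_linear/mul_bilinear. Qed.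
HB.instance Definition _ f g :=
  GRing.isLinear.Build K B A *:%R (conv f g) (conv_linear f g).

Lemma mul_trilinear f g h : trilinear (fun x y z => f x * g y * h z).
Proof.
split=> [y z|x z|x y] a u v /=; rewrite linearP.
- by rewrite !mulrDl !scalerAl.
- by rewrite mulrDr mulrDl -scalerAr !scalerAl.
- by rewrite mulrDr scalerAr.
Qed.

Lemma sweedler3_conv f g h b :
  sweedler3 (fun x y z => f x * g y * h z) b = conv (conv f g) h b.
Proof.
rewrite sweedler3_left; last exact: mul_trilinear.
by apply: eq_sweedler2 => u z; rewrite -sweedler2_mulr.
Qed.

Lemma convA f g h : conv f (conv g h) =1 conv (conv f g) h.
Proof.
move=> b; rewrite -sweedler3_conv sweedler3_right; last exact: mul_trilinear.
apply: eq_sweedler2 => x u; rewrite sweedler2_mull.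
by apply: eq_sweedler2 => y z; rewrite mulrA.
Qed.

(** Composing with the unit of A makes scalar-valued maps convolvable with
    A-valued ones; [unit_scale eps] is the neutral element of convolution. *)
Definition unit_scale (phi : B -> K^o) (b : B) : A := (phi b)%:A.

Lemma unit_scale_linear (phi : {linear B -> K^o}) : linear (unit_scale phi).
Proof. by move=> a b c; rewrite /unit_scale linearP scalerDl scalerA. Qed.
HB.instance Definition _ (phi : {linear B -> K^o}) :=
  GRing.isLinear.Build K B A *:%R (unit_scale phi) (unit_scale_linear phi).

Lemma convr1 g : conv g (unit_scale eps) =1 g.
Proof.
move=> b; rewrite -[RHS]sweedler2_counitr.
by apply: eq_sweedler2 => x y; rewrite mulr_algr.
Qed.

Lemma eq_conv f f' g g' : f =1 f' -> g =1 g' -> conv f g =1 conv f' g'.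
Proof. by move=> ff gg b; apply: eq_sweedler2 => x y; rewrite ff gg. Qed.

(** The double sum is the shape that comultiplicativity gives to the value at
    a product b c; commutativity of A separates the variables. *)
Lemma sweedler2_mul2 f f' g g' b c : commutative (@GRing.mul A) ->
  sweedler2 (fun x y => sweedler2 (fun z w => (f x * g z) * (f' y * g' w)) c) b
  = conv f f' b * conv g g' c.
Proof.
move=> mulAC; rewrite sweedler2_mulr; apply: eq_sweedler2 => x y.
rewrite sweedler2_mull; apply: eq_sweedler2 => z w.
by rewrite -!mulrA; congr (_ * _); rewrite !mulrA; congr (_ * _); exact: mulAC.
Qed.

(** The algebraic form of the statement that a class function takes the same
    value at x y and at y x. *)
Lemma conv_cosymmetric f g t : commutative (@GRing.mul A) -> cosymmetric t ->
  conv f g t = conv g f t.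
Proof.
move=> mulAC cos_t.
rewrite /conv sweedler2_cosymmetric //; last exact: mul_bilinear.
by apply: eq_sweedler2 => x y; rewrite mulAC.
Qed.

(** Derivations relative to u.  Convolution does not preserve the case
    where u is the counit: u is convolved along with D, so a general u is
    needed to pass through s * m before reaching s * m * id. *)
Definition leibniz (u D : {linear B -> A}) : Prop :=
  forall b c, D (b * c) = u b * D c + u c * D b.

Lemma conv_leibnizl u D f : commutative (@GRing.mul A) ->
  {morph f : x y / x * y} -> leibniz u D -> leibniz (conv u f) (conv D f).
Proof.
move=> mulAC fM DM b c.
rewrite [LHS]sweedler2M; last exact: mul_bilinear.
rewrite -(sweedler2_mul2 u f D f) //.
rewrite [X in _ + X]mulAC -(sweedler2_mul2 D f u f) //.
rewrite -sweedler2D; apply: eq_sweedler2 => x y.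
rewrite -sweedler2D; apply: eq_sweedler2 => z w.
by rewrite fM DM -mulrDl [u z * _]mulAC.
Qed.

Lemma conv_leibnizr u D f : commutative (@GRing.mul A) ->
  {morph f : x y / x * y} -> leibniz u D -> leibniz (conv f u) (conv f D).
Proof.
move=> mulAC fM DM b c.
rewrite [LHS]sweedler2M; last exact: mul_bilinear.
rewrite -(sweedler2_mul2 f u f D) //.
rewrite [X in _ + X]mulAC -(sweedler2_mul2 f D f u) //.
rewrite -sweedler2D; apply: eq_sweedler2 => x y.
rewrite -sweedler2D; apply: eq_sweedler2 => z w.
by rewrite fM DM -mulrDr [u w * _]mulAC.
Qed.

End Convolution.

Section Antipode.
Variables (K : comNzRingType) (B : hopfAlgType K).
Hypothesis mulBC : commutative (@GRing.mul B).

Local Notation eps := (@counit K B).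
Local Notation antip := (@antipode K B).
Local Notation "1eps" := (@unit_scale K B B eps).

Lemma conv_antipodel : conv antip idfun =1 1eps.
Proof. exact: antipodel. Qed.

Lemma conv_antipoder : conv idfun antip =1 1eps.
Proof. exact: antipoder. Qed.

(** The identity of B is invertible for convolution, with inverse the antipode,
    hence right convolution by it can be cancelled. *)
Lemma conv_id_inj (f g : B -> B) : linear f -> linear g ->
    (forall b, sweedler2 (fun x y => f x * y) b =
               sweedler2 (fun x y => g x * y) b) ->
  f =1 g.
Proof.
move=> linf ling fg b.
have cancelK (h : {linear B -> B}) : conv (conv h idfun) antip =1 h.
  move=> c; rewrite -convA -[RHS]convr1.
  by apply: eq_conv => //; apply: conv_antipoder.
pose f' : {linear B -> B} :=
  HB.pack f (GRing.isLinear.Build K B B *:%R f linf).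
pose g' : {linear B -> B} :=
  HB.pack g (GRing.isLinear.Build K B B *:%R g ling).
rewrite -[f b](cancelK f') -[g b](cancelK g').
exact: eq_conv.
Qed.

(** Both sides, as functions of x and y, are convolution inverses of the
    multiplication B (x) B -> B.  Instead of convolving over B (x) B, one
    cancels the identity in one variable at a time, first y and then x. *)
Lemma antipodeM : {morph antip : x y / x * y}.
Proof.
have linl y : linear (fun x => antip (x * y)).
  by move=> a u v; rewrite mulrDl -scalerAl linearP.
have linr x : linear (fun y => antip (x * y)).
  by move=> a u v; rewrite mulrDr -scalerAr linearP.
have bil_mul : bilinear_for *:%R *:%R (fun x y : B => antip x * y).
  exact: (mul_bilinear antip idfun).
move=> x y; apply: (conv_id_inj (f := fun y => antip (x * y))
  (g := fun y => antip x * antip y)) y => [||y].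
- exact: linr.
- by move=> a u v; rewrite linearP mulrDr scalerAr.
have -> : sweedler2 (fun z w => antip x * antip z * w) y = eps y *: antip x.
  rewrite -mulr_algr -antipodel [RHS]sweedler2_mull.
  by apply: eq_sweedler2 => z w; rewrite mulrA.
(* What is left is an equality of functions of x for fixed y; both sides
   convolve with the identity to eps x * eps y. *)
apply: (conv_id_inj
  (f := fun x => sweedler2 (fun z w => antip (x * z) * w) y)
  (g := fun x => eps y *: antip x)) x => [||x].
- apply: tlift_family_linear => z w a u v.
  by rewrite linl mulrDl scalerAl.
- by move=> a u v; rewrite linearP scalerDr !scalerA mulrC.
transitivity (sweedler2 (fun z w => antip z * w) (x * y)).
  rewrite sweedler2M //; apply: eq_sweedler2 => z w; rewrite sweedler2_mulr.
  by apply: eq_sweedler2 => z' w'; rewrite -mulrA [w' * w]mulBC.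
rewrite [LHS]antipodel counitM mulrC -scalerA -antipodel.
rewrite -mulr_algl [LHS]sweedler2_mull.
by apply: eq_sweedler2 => z w; rewrite mulrA mulr_algl.
Qed.

End Antipode.

(** * The cotangent space *)

Section Cotangent.
Variables (K : comNzRingType) (B : hopfAlgType K).

Local Notation eps := (@counit K B).

Definition point_derivation (V : lmodType K) (nu : B -> V) : Prop :=
  forall b c, nu (b * c) = eps b *: nu c + eps c *: nu b.

Lemma cotangent_projM : point_derivation (@cotangent_proj K B).
Proof.
move=> b c; rewrite -!linearZ -linearD; apply/mprojP.
set z := _ - _; suff : aug_prod z by exact: spanned_sub.
exists (aug_part b), (aug_part c).
have epsE : eps (eps b *: c + eps c *: b) = eps b * eps c + eps b * eps c.
  by rewrite linearD !linearZ /= [eps c * _]mulrC.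
rewrite /= epsE counitM scalerDl mulrBl !mulrBr mulr_algr !mulr_algl scalerA.
(* An identity in the additive group, with e = (eps b * eps c) *: 1. *)
move: (_ *: 1) (_ *: b) (_ *: c) (b * c) => e u v w.
rewrite !opprD !opprK addrA.
rewrite -!addrA; congr (_ + _); rewrite !addrA.
by rewrite [- e - v]addrC [- v - e - u]addrAC subrK [- v - u]addrC.
Qed.

Section Lift.
Variables (V : lmodType K) (nu : {linear B -> V}).
Hypothesis nuM : point_derivation nu.

Lemma point_derivation1 : nu 1 = 0.
Proof.
apply: (addrI (nu 1)); rewrite addr0.
by rewrite -{3}[1](mulr1 (1 : B)) nuM counit1 !scale1r.
Qed.

Lemma point_derivation_aug_sq (z : aug_ideal B) :
  spanned (@aug_prod K B) z -> nu (\val z) = 0.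
Proof.
move=> /(_ (fun z => nu (\val z) = 0)); apply.
  split=> [|x y x0 y0|a x x0]; first by rewrite !linear0.
    by rewrite !linearD x0 y0 addr0.
  by rewrite !linearZ /= x0 scaler0.
move=> s [x [y ->]]; rewrite nuM.
by rewrite (eqP (valP x)) (eqP (valP y)) !scale0r addr0.
Qed.

Definition cotangent_lift (z : cotangent B) : V := nu (\val (repr z)).

Lemma cotangent_lift_mproj (x : aug_ideal B) :
  cotangent_lift (mproj (@aug_prod K B) x) = nu (\val x).
Proof.
apply/eqP; rewrite -subr_eq0 -!linearB; apply/eqP/point_derivation_aug_sq.
by apply/mprojP; rewrite mproj_repr.
Qed.

Lemma cotangent_lift_linear : linear cotangent_lift.
Proof.
move=> a u v; rewrite -[u]mproj_repr -[v]mproj_repr -linearP.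
by rewrite !cotangent_lift_mproj !linearP.
Qed.

Lemma cotangent_liftE b : cotangent_lift (cotangent_proj b) = nu b.
Proof.
rewrite cotangent_lift_mproj /= linearB linearZ /=.
by rewrite point_derivation1 scaler0 subr0.
Qed.

End Lift.
End Cotangent.

(** * The form of a trace-like element *)

Section TraceForm.
Variables (K : comNzRingType) (B : hopfAlgType K) (t : B).

Local Notation eps := (@counit K B).
Local Notation antip := (@antipode K B).

Lemma derivation_linear (mu : derivation B) : linear (mu : B -> K^o).
Proof. by case: (in_derivationP _ (valP mu)). Qed.

Lemma derivationM (mu : derivation B) b c :
  mu (b * c) = eps b * mu c + eps c * mu b.
Proof. by case: (in_derivationP _ (valP mu)) => _; apply. Qed.

Definition to_linear (mu : derivation B) : {linear B -> K^o} :=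
  HB.pack (mu : B -> K^o)
    (GRing.isLinear.Build K B K^o *:%R (mu : B -> K^o) (derivation_linear mu)).

Hypothesis nonsing_t : infinitesimally_nonsingular t.

Lemma contraction_assoc_derivation b :
  contraction t (assoc_derivation t b) = cotangent_proj b.
Proof.
have [inv _ invK] := nonsing_t.
apply: (@xgetPex _ 0 [set mu | contraction t mu = cotangent_proj b]%classic).
by exists (inv (cotangent_proj b)); apply: invK.
Qed.

(** The reproducing formula: apply the map induced by nu on I / I^2 to the
    equation that characterizes the derivation associated with b. *)
Lemma trace_form_expand (V : lmodType K) (nu : {linear B -> V}) b :
    point_derivation nu ->
  nu b = sweedler2 (fun x y => trace_form t b x *: nu y) t.
Proof.
move=> nuM; rewrite -[LHS](cotangent_liftE nuM) -contraction_assoc_derivation.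
rewrite /contraction /sweedler2 linear_fun_tlift;
  last exact: cotangent_lift_linear.
apply: eq_tlift => x y.
by rewrite -linearZ (cotangent_liftE nuM) linearZ.
Qed.

(** As the contraction is injective, a linear relation between classes in
    I / I^2 lifts to the associated derivations. *)
Lemma eq_trace_form b b1 b2 a1 a2 c :
    cotangent_proj b = a1 *: cotangent_proj b1 + a2 *: cotangent_proj b2 ->
  trace_form t b c = a1 * trace_form t b1 c + a2 * trace_form t b2 c.
Proof.
move=> pb.
have muE : assoc_derivation t b =
    a1 *: assoc_derivation t b1 + a2 *: assoc_derivation t b2.
  have /bij_inj inj_t := nonsing_t; apply: inj_t.
  by rewrite linearD !linearZ /= !contraction_assoc_derivation.
rewrite /trace_form muE /derivation_fun.
by [].
Qed.

Lemma trace_form_biderivation : biderivation (trace_form t).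
Proof.
split.
- split=> [c a b b'|b]; last exact: derivation_linear.
  rewrite /= -[X in _ = _ + X]mul1r.
  by apply: eq_trace_form; rewrite linearP scale1r.
- by move=> b c d; apply/eq_trace_form/cotangent_projM.
- by move=> b c d; apply: derivationM.
Qed.

Lemma trace_form_contract b c : cosymmetric t ->
  trace_form t b c =
  sweedler2 (V := K^o) (fun x y => trace_form t b x * trace_form t c y) t.
Proof.
move=> cos_t; pose mu_b := to_linear (assoc_derivation t b).
pose mu_c := to_linear (assoc_derivation t c).
rewrite sweedler2_cosymmetric //; last exact: (mul_bilinear mu_b mu_c).
rewrite -[LHS]/(mu_b c) (trace_form_expand (nu := mu_b)) //; last first.
  exact: derivationM.
by apply: (@eq_sweedler2 _ _ K^o) => x y; apply: mulrC.
Qed.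

Hypothesis mulBC : commutative (@GRing.mul B).

Definition derivation_inB mu : {linear B -> B} :=
  unit_scale B (to_linear mu).

Lemma derivation_inB_leibniz mu :
  leibniz (unit_scale B eps) (derivation_inB mu).
Proof.
move=> b c; rewrite /derivation_inB /= /unit_scale !mulr_algl !scalerA.
rewrite -scalerDl.
by congr (_ *: _); apply: derivationM.
Qed.

Lemma leibniz_counit (u D : {linear B -> B}) : u =1 unit_scale B eps ->
  leibniz u D -> point_derivation D.
Proof. by move=> ue DM b c; rewrite DM !ue !mulr_algl. Qed.

Lemma trace_form_conv (nu : {linear B -> B}) b :
    point_derivation nu ->
  nu b = conv (derivation_inB (assoc_derivation t b)) nu t.
Proof.
move=> nuM; rewrite trace_form_expand //.
by apply: eq_sweedler2 => x y; rewrite mulr_algl.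
Qed.

(** Both sides are values of conjugates of point derivations; expanding each
    by the reproducing formula yields the values at t of two convolution
    products of four factors that differ by a cyclic permutation. *)
Lemma trace_form_balanced : cosymmetric t -> balanced (trace_form t).
Proof.
move=> cos_t b c.
pose mu_b := derivation_inB (assoc_derivation t b).
pose mu_c := derivation_inB (assoc_derivation t c).
pose Fb : {linear B -> B} := conv (conv antip mu_b) idfun.
pose Gc : {linear B -> B} := conv (conv idfun mu_c) antip.
have idM : {morph idfun : x y / x * y :> B} by [].
have antipM := antipodeM mulBC.
transitivity (Fb c).
  rewrite -[RHS]/(conv (conv antip mu_b) idfun c) -sweedler3_conv.
  apply: eq_tlift => u z; apply: eq_tlift => x y.
  by rewrite mulr_algr scalerAl.
transitivity (Gc b); last first.
  rewrite -[LHS]/(conv (conv idfun mu_c) antip b) -sweedler3_conv.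
  apply: eq_tlift => u z; apply: eq_tlift => x y.
  by rewrite mulr_algr -scalerAl mulBC.
have FbM : point_derivation Fb.
  apply: (leibniz_counit (u := conv (conv antip (unit_scale B eps)) idfun)).
    move=> d; rewrite -[RHS]conv_antipodel.
    by apply: eq_conv => // d'; apply: convr1.
  apply: conv_leibnizl => //; apply: conv_leibnizr => //.
  exact: derivation_inB_leibniz.
have GcM : point_derivation Gc.
  apply: (leibniz_counit (u := conv (conv idfun (unit_scale B eps)) antip)).
    move=> d; rewrite -[RHS]conv_antipoder.
    by apply: eq_conv => // d'; apply: convr1.
  apply: conv_leibnizl => //; apply: conv_leibnizr => //.
  exact: derivation_inB_leibniz.
(* Brackets m * (id * m' * s) as (m * id) * (m' * s): the cyclic permutation is
   then the exchange of the two factors. *)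
have regroup (f g h k : {linear B -> B}) :
    conv f (conv (conv g h) k) =1 conv (conv f g) (conv h k).
  move=> d; rewrite -[RHS]convA; apply: eq_conv => // d'.
  by rewrite /= -convA.
rewrite (trace_form_conv _ FbM) (trace_form_conv _ GcM) !regroup.
exact: conv_cosymmetric.
Qed.

End TraceForm.

Theorem lemma7p2 (K : comNzRingType) (B : hopfAlgType K)
    (mulB_comm : commutative (@GRing.mul B)) (t : B) (ht : trace_like t) :
  [/\ biderivation (trace_form t),
      balanced (trace_form t)
    & forall b c : B,
        trace_form t b c =
        sweedler2 (V := K^o) (fun t1 t2 => trace_form t b t1 * trace_form t c t2) t].
Proof.
have [cos_t nonsing_t] := ht; split.
- exact: trace_form_biderivation.
- exact: trace_form_balanced.
- by move=> b c; apply: trace_form_contract.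
Qed.
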